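(* Let $C$ be a polygonal chain of $n$ planar points, and let $\langle n_1,\dots,n_\kappa\rangle$ be the sizes of the subchains of any partition $\Pi$ of $C$ into the minimum number $\kappa$ of simple subchains. Then the running time of the Test-And-Divide algorithm on input $C$ is within $O(n(1+\mathcal{H}(n_1,\dots,n_\kappa)))\subseteq O(n(1+\log\kappa))\subseteq O(n\log n)$, and this bound is worst-case optimal in the comparison model over instances of $n$ points that can be partitioned into $\kappa$ simple subchains of sizes $\langle n_1,\dots,n_\kappa\rangle$ (i.e., any comparison-based algorithm computing the convex hull requires $\Omega(n(1+\mathcal{H}(n_1,\dots,n_\kappa)))$ time in the worst case over such instances).
   Context: A polygonal chain is a sequence of points $p_1,\dots,p_n$ in the plane together with the segments joining consecutive points; a subchain is a contiguous subsequence, and a partition of $C$ into subchains is a cut of the sequence into consecutive pieces. A chain is simple if any two non-adjacent edges are disjoint or meet only at a vertex of the chain, and any two adjacent edges share only their common vertex. The Test-And-Divide algorithm computes the convex hull of a polygonal chain $C$: it tests in linear time whether $C$ is simple; if so it computes the convex hull of $C$ in linear time (Melkman's algorithm); otherwise it cuts $C$ into two consecutive subchains of sizes $\lceil n/2\rceil$ and $\lfloor n/2\rfloor$, recurses on each, and merges the two resulting convex hulls in linear time. For positive integers $n_1,\dots,n_k$ summing to $n$, $\mathcal{H}(n_1,\dots,n_k)=\sum_{i=1}^k\frac{n_i}{n}\log\frac{n}{n_i}$. *)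

(* Defs.v *)
From mathcomp Require Import all_boot all_order all_algebra.
From mathcomp Require Import all_classical all_reals all_analysis.
From mathcomp Require Import zify.

Set Implicit Arguments.
Unset Strict Implicit.
Unset Printing Implicit Defensive.

Import Order.TTheory GRing.Theory Num.Theory.
Import numFieldNormedType.Exports.

Local Open Scope classical_set_scope.
Local Open Scope ring_scope.

(** Polygonal chains *)

Notation plane R := 'rV[R]_2.
Notation chain R := (seq (plane R)).

Definition segment (R : realType) (a b : plane R) : set (plane R) :=
  [set (1 - t) *: a + t *: b | t in [set t : R | 0 <= t <= 1]].

Definition edge (R : realType) (C : chain R) (i : nat) : set (plane R) :=
  segment C`_i C`_i.+1.

(** Edges [i] and [i.+1] are the adjacent ones.  Non-adjacent edges may touch
    at a vertex; that vertex has to be an endpoint of one of the two edges (it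
    may lie in the interior of the other one).  In particular a chain whose
    last point is its first one can be simple, and every subchain of a simple
    chain is simple. *)
Definition simple_chain (R : realType) (C : chain R) : Prop :=
  forall i j : nat, (i < j)%N -> (j.+1 < size C)%N ->
  forall p : plane R, edge C i p -> edge C j p ->
    if j == i.+1 then p = C`_j
    else p \in [:: C`_i; C`_i.+1; C`_j; C`_j.+1].

Definition simple_partition (R : realType) (C : chain R)
    (P : seq (chain R)) : Prop :=
  flatten P = C /\
  forall D : chain R, D \in P -> D <> [::] /\ simple_chain D.

Definition min_simple_partition (R : realType) (C : chain R)
    (P : seq (chain R)) : Prop :=
  simple_partition C P /\
  forall Q : seq (chain R), simple_partition C Q -> (size P <= size Q)%N.

(** Convex hulls *)

(** Twice the signed area of the triangle [p q r]. *)
Definition orient (R : realType) (p q r : plane R) : R :=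
  (q 0 0 - p 0 0) * (r 0 1 - p 0 1) - (q 0 1 - p 0 1) * (r 0 0 - p 0 0).

(** [h] lists the vertices of the convex hull of the points of [C], each of
    them once, in counterclockwise order from an arbitrary one of them. *)
Definition is_hull (R : realType) (C h : chain R) : Prop :=
  [/\ uniq h,
      {subset h <= C},
      forall i j k : nat, (i < j)%N -> (j < k)%N -> (k < size h)%N ->
        0 < orient h`_i h`_j h`_k &
      [set` C] `<=` smallest (@convex_set R (plane R)) [set` h]].

(** Entropy of a sequence of sizes *)

Definition log2 (R : realType) (x : R) : R := ln x / ln 2.

Definition entropy (R : realType) (ns : seq nat) : R :=
  let n : R := (sumn ns)%:R in
  \sum_(m <- ns) m%:R / n * log2 (n / m%:R).

(** The Test-And-Divide algorithm *)

(** The subroutines of the algorithm, each one given by what it returns and by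
    the number of steps it takes. *)
Record subroutines (R : realType) := Subroutines {
  is_simple : chain R -> bool;
  is_simple_time : chain R -> nat;
  simple_hull : chain R -> chain R;
  simple_hull_time : chain R -> nat;
  cut_time : chain R -> nat;
  merge_hulls : chain R -> chain R -> chain R;
  merge_hulls_time : chain R -> chain R -> nat;
  time_factor : nat;
  _ : forall C, is_simple C <-> simple_chain C;
  _ : forall C, (is_simple_time C <= time_factor * size C)%N;
  _ : forall C, simple_chain C -> is_hull C (simple_hull C);
  _ : forall C, simple_chain C ->
        (simple_hull_time C <= time_factor * size C)%N;
  _ : forall C, (cut_time C <= time_factor * size C)%N;
  _ : forall C1 C2 h1 h2, is_hull C1 h1 -> is_hull C2 h2 ->
        is_hull (C1 ++ C2) (merge_hulls h1 h2);
  _ : forall C1 C2 h1 h2, is_hull C1 h1 -> is_hull C2 h2 ->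
        (merge_hulls_time h1 h2 <= time_factor * (size h1 + size h2))%N
}.

(** Returns the hull and the number of steps.  The parts of a chain that is
    not simple are shorter than the chain, so that recursion depth [size C]
    is never exceeded: see [test_and_divideE]. *)
Fixpoint test_and_divide_rec (R : realType) (S : subroutines R) (depth : nat)
    (C : chain R) : chain R * nat :=
  if depth is d.+1 then
    if is_simple S C then
      (simple_hull S C, is_simple_time S C + simple_hull_time S C)%N
    else
      let: (h1, t1) := test_and_divide_rec S d (take (uphalf (size C)) C) in
      let: (h2, t2) := test_and_divide_rec S d (drop (uphalf (size C)) C) in
      (merge_hulls S h1 h2,
       is_simple_time S C + cut_time S C + t1 + t2 + merge_hulls_time S h1 h2)%N
  else ([::], 0%N).

Definition test_and_divide (R : realType) (S : subroutines R) (C : chain R) :=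
  test_and_divide_rec S (size C) C.

Definition tad_time (R : realType) (S : subroutines R) (C : chain R) : nat :=
  (test_and_divide S C).2.

Lemma is_simpleP (R : realType) (S : subroutines R) (C : chain R) :
  is_simple S C <-> simple_chain C.
Proof. by case: S. Qed.

Lemma non_simple_size (R : realType) (S : subroutines R) (C : chain R) :
  ~~ is_simple S C -> (2 < size C)%N.
Proof.
apply: contraR; rewrite -leqNgt => sC; apply/is_simpleP => i j ij jC.
by exfalso; lia.
Qed.

Lemma test_and_divide_rec_depth (R : realType) (S : subroutines R)
    (d e : nat) (C : chain R) :
  (0 < size C)%N -> (size C <= d)%N -> (size C <= e)%N ->
  test_and_divide_rec S d C = test_and_divide_rec S e C.
Proof.
elim: d e C => [|d IHd] [|e] C C0 Cd Ce; try by exfalso; lia.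
rewrite /=; case: ifPn => // /non_simple_size C2; set m := uphalf (size C).
have st : size (take m C) = m by rewrite size_takel // /m; lia.
have sd : size (drop m C) = (size C - m)%N by rewrite size_drop.
have mP : [/\ (0 < m)%N, (m < size C)%N & (0 < size C - m < size C)%N].
  by rewrite /m; split; lia.
case: mP => m0 mC /andP[n0 nC].
by rewrite (IHd e (take m C)) ?(IHd e (drop m C)) ?st ?sd //; lia.
Qed.

Lemma test_and_divideE (R : realType) (S : subroutines R) (C : chain R) :
  C <> [::] ->
  test_and_divide S C =
    if is_simple S C then
      (simple_hull S C, is_simple_time S C + simple_hull_time S C)%N
    else
      let: (h1, t1) := test_and_divide S (take (uphalf (size C)) C) in
      let: (h2, t2) := test_and_divide S (drop (uphalf (size C)) C) in
      (merge_hulls S h1 h2,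
       is_simple_time S C + cut_time S C + t1 + t2 + merge_hulls_time S h1 h2)%N.
Proof.
move=> C0.
have sC : (0 < size C)%N by rewrite lt0n size_eq0; apply/eqP.
rewrite /test_and_divide.
rewrite (@test_and_divide_rec_depth _ S (size C) (size C).+1) //=.
case: ifPn => // /non_simple_size C2; set m := uphalf (size C).
have st : size (take m C) = m by rewrite size_takel // /m; lia.
have sd : size (drop m C) = (size C - m)%N by rewrite size_drop.
have mP : [/\ (0 < m)%N, (m < size C)%N & (0 < size C - m < size C)%N].
  by rewrite /m; split; lia.
case: mP => m0 mC /andP[n0 nC].
rewrite (@test_and_divide_rec_depth _ S (size C) (size (take m C))) ?st //;
  last by lia.
rewrite (@test_and_divide_rec_depth _ S (size C) (size (drop m C))) ?sd //.
by lia.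
Qed.

(** Asymptotics *)

(** The inputs [C], each with a partition of [C] into the minimum number of
    simple subchains. *)
Record instance (R : realType) := Instance {
  input : chain R;
  parts : seq (chain R);
  _ : min_simple_partition input parts
}.

Definition input_size (R : realType) (I : instance R) : nat := size (input I).

(** The filter "the number of points tends to infinity". *)
Definition large_inputs {R : realType} : set_system (instance R) :=
  filter_from setT (fun N : nat => [set I | (N <= input_size I)%N]).

Global Instance large_inputs_filter (R : realType) : Filter (@large_inputs R).
Proof.
apply: filter_fromT_filter; first by exists 0%N.
by move=> i j; exists (maxn i j) => I /=; rewrite geq_max => /andP[].
Qed.

Canonical large_inputs_filterType (R : realType) :=
  FilterType (@large_inputs R) (@large_inputs_filter R).

(** The class O(g), as the number of points tends to infinity. *)
Definition O_class (R : realType) (g : instance R -> R) :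
    set (instance R -> R) :=
  [set f : instance R -> R^o | f =O_large_inputs (g : instance R -> R^o)].

Lemma O_classP (R : realType) (f g : instance R -> R) :
  O_class g f <-> exists2 K : R, 0 < K & exists N : nat,
    forall I : instance R, (N <= input_size I)%N -> `|f I| <= K * `|g I|.
Proof.
split=> [/eqOP/bigO_exP[K K0 [N _ NK]]|[K K0 [N NK]]].
  by exists K => //; exists N.
by apply/eqOP/bigO_exP; exists K => //; exists N.
Qed.

(** The comparison model *)

(** An algorithm on [n] points: it accesses them only through three-way
    comparisons of two quantities which depend on the points, and it returns
    indices of points. *)
Inductive decision_tree (R : realType) (n : nat) : Type :=
| Return of seq 'I_n
| Compare (f g : n.-tuple (plane R) -> R)
    (if_lt if_eq if_gt : decision_tree R n).

Fixpoint run (R : realType) (n : nat) (A : decision_tree R n)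
    (C : n.-tuple (plane R)) : seq 'I_n * nat :=
  match A with
  | Return s => (s, 0%N)
  | Compare f g if_lt if_eq if_gt =>
      let: (s, t) := run (if f C < g C then if_lt
                          else if f C == g C then if_eq else if_gt) C in
      (s, t.+1)
  end.

Definition output (R : realType) (n : nat) (A : decision_tree R n)
    (C : n.-tuple (plane R)) : chain R :=
  [seq tnth C i | i <- (run A C).1].

Definition comparisons (R : realType) (n : nat) (A : decision_tree R n)
    (C : n.-tuple (plane R)) : nat := (run A C).2.

(** The chains that can be cut into simple subchains of sizes [ns]. *)
Definition splittable (R : realType) (ns : seq nat) : set (chain R) :=
  [set C | exists2 P : seq (chain R), simple_partition C P & shape P = ns].

(* Main.v *)
(** Upper bound.  Only a subchain that is not contained in a piece of the
    partition can fail the simplicity test, so the time is, up to a constant,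
    [n] plus the total size of the subchains that meet two pieces.  The part of
    that total that falls on a piece of [m] points is at most
    [min m (2 * 2 ^ j)] on the level of the subchains of about [2 ^ j] points:
    each of the two ends of the piece lies in one of them.  Summing over [j]
    gives [m * (log (n / m) + O(1))], and then [n * (H + O(1))] in total.

    Lower bound.  Since [k] comparisons distinguish at most [3 ^ k] outputs, it
    suffices to count hulls.  An assignment of the points [(x, x ^ 2)] to the
    pieces, in increasing order inside each piece, is a splittable chain of
    which the hull shows the order of all the points: this gives
    [n! / \prod_i n_i!] hulls up to rotation, and [n * H - O(n)] comparisons.
    Moving an arbitrary subset of the points of one parabola to a chord gives
    [2 ^ (n - 2)] hulls, and [n - 2] comparisons up to a constant.  The two
    bounds combine to a multiple of [n * (1 + H)]. *)
Require Import Defs.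
From mathcomp Require Import all_boot all_order all_algebra.
From mathcomp Require Import all_classical all_reals all_analysis.
From mathcomp Require Import zify lra ring.

Set Implicit Arguments.
Unset Strict Implicit.
Unset Printing Implicit Defensive.

Import Order.TTheory GRing.Theory Num.Theory.

Local Open Scope classical_set_scope.
Local Open Scope ring_scope.

(** * Simple subchains and the charge of a piece *)

Lemma simple_take (R : realType) (C : chain R) (m : nat) :
  simple_chain C -> simple_chain (take m C).
Proof.
move=> sC i j ij; rewrite size_take_min leq_min => /andP[jm jC] p.
by rewrite /edge !nth_take; [exact: sC|lia..].
Qed.

Lemma simple_drop (R : realType) (C : chain R) (m : nat) :
  simple_chain C -> simple_chain (drop m C).
Proof.
move=> sC i j ij; rewrite size_drop => jC p.
rewrite /edge !nth_drop !addnS -[j == _](eqn_add2l m) addnS.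
by apply: sC; lia.
Qed.

(* Bounds, up to a constant, the time that the recursion on a chain of at most
   [2 ^ d] points spends on [m] consecutive points of a simple piece of which
   [e] ends lie inside the chain. *)
Definition piece_charge (e d m : nat) : nat :=
  (\sum_(j < d.+1) minn m (e * 2 ^ j))%N.

Lemma piece_chargeS (e d m : nat) :
  piece_charge e d.+1 m = (piece_charge e d m + minn m (e * 2 ^ d.+1))%N.
Proof. by rewrite /piece_charge big_ord_recr. Qed.

Lemma leq_piece_charge (e d m m' : nat) :
  (m <= m')%N -> (piece_charge e d m <= piece_charge e d m')%N.
Proof. by move=> mm; apply: leq_sum => j _; lia. Qed.

(** Used when a cut falls inside a piece: each of the two parts keeps one end of the piece, and the
    bound holds on every level separately. *)
Lemma piece_chargeD (d a b : nat) :
  (piece_charge 1 d a + piece_charge 1 d b <= piece_charge 2 d (a + b))%N.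
Proof.
rewrite /piece_charge -big_split /=; apply: leq_sum => j _.
rewrite mul1n; lia.
Qed.

(** The top level charges every point once, so that over all pieces it yields the size of the
    chain. *)
Lemma piece_chargeS_small (e d m : nat) : (0 < e)%N -> (m <= 2 ^ d.+1)%N ->
  piece_charge e d.+1 m = (piece_charge e d m + m)%N.
Proof. by rewrite piece_chargeS => e0 md; congr addn; apply/minn_idPl; nia. Qed.

(** * Running time of the recursion in terms of charges *)

Section TestAndDivide.
Variables (R : realType) (S : subroutines R).
Implicit Types C D A B : chain R.

Lemma is_hull_size C h : is_hull C h -> (size h <= size C)%N.
Proof. by case=> u s _ _; exact: uniq_leq_size. Qed.

Lemma halves_neq_nil C : ~~ is_simple S C ->
  [/\ C <> [::], take (uphalf (size C)) C <> [::] &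
      drop (uphalf (size C)) C <> [::]].
Proof.
move=> /non_simple_size C2.
by split=> /(congr1 size); rewrite ?size_take_min ?size_drop /=; lia.
Qed.

(** The time of a merge is bounded only on genuine hulls, so the time analysis depends on
    correctness. *)
Lemma tad_hull C : C <> [::] -> is_hull C (test_and_divide S C).1.
Proof.
have [n] := ubnP (size C); elim: n C => // n IHn C Cn C0.
rewrite test_and_divideE //; case: ifPn => [/is_simpleP|nC].
  by case: (S) => /= *; auto.
have [_ t0 d0] := halves_neq_nil nC.
have C2 := non_simple_size nC.
have := IHn _ _ t0; have := IHn _ _ d0.
case: (test_and_divide S (take _ C)) => h1 t1.
case: (test_and_divide S (drop _ C)) => h2 t2 /= H2 H1.
rewrite -{1}(cat_take_drop (uphalf (size C)) C).
have {}H1 : is_hull (take (uphalf (size C)) C) h1.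
  by apply: H1; rewrite size_take_min; lia.
have {}H2 : is_hull (drop (uphalf (size C)) C) h2.
  by apply: H2; rewrite size_drop; lia.
by move: H1 H2; case: (S) => /= *; auto.
Qed.

Lemma tad_time_simple C :
  simple_chain C -> (tad_time S C <= 2 * time_factor S * size C)%N.
Proof.
case: (altP (C =P [::])) => [->|/eqP C0] sC; first by [].
rewrite /tad_time test_and_divideE //.
have /is_simpleP -> /= := sC.
rewrite -mulnA mul2n -addnn.
by move: sC; case: (S) => /= *; apply: leq_add; auto.
Qed.

(** The factor 3 accounts for the test, the cut and the merge; the hulls to merge are no larger than
    the two halves. *)
Lemma tad_time_split C : ~~ is_simple S C ->
  (tad_time S C <= 3 * time_factor S * size C +
     tad_time S (take (uphalf (size C)) C) +
     tad_time S (drop (uphalf (size C)) C))%N.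
Proof.
move=> nC; have [C0 t0 d0] := halves_neq_nil nC.
rewrite /tad_time (test_and_divideE _ C0) (negbTE nC).
have := tad_hull t0; have := tad_hull d0.
case: (test_and_divide S (take _ C)) => h1 t1.
case: (test_and_divide S (drop _ C)) => h2 t2 /= H2 H1.
have l1 := is_hull_size H1; have l2 := is_hull_size H2.
have szE : (size (take (uphalf (size C)) C) + size (drop (uphalf (size C)) C)
            = size C)%N by rewrite -size_cat cat_take_drop.
have ts : (is_simple_time S C <= time_factor S * size C)%N by case: (S).
have tc : (cut_time S C <= time_factor S * size C)%N by case: (S).
have tm : (merge_hulls_time S h1 h2 <= time_factor S * (size h1 + size h2))%N.
  by move: H1 H2; case: (S) => /= *; eauto.
have : (time_factor S * (size h1 + size h2) <= time_factor S * size C)%N.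
  by rewrite leq_mul2l -szE leq_add ?orbT.
by rewrite -mulnA mulSn mul2n -addnn; lia.
Qed.

Lemma cat_flatten_split (P : seq (chain R)) (u : nat) :
  (u <= size (flatten P))%N -> P <> [::] ->
  exists P1 D P2, [/\ P = P1 ++ D :: P2, (size (flatten P1) <= u)%N &
    (u - size (flatten P1) <= size D)%N].
Proof.
elim: P u => // D P IH u; rewrite /= size_cat => uP _.
have [uD|Du] := leqP u (size D).
  by exists [::], D, P; split => //=; rewrite subn0.
case: P => [|E P] in IH uP *; first by move: uP; rewrite /= addn0; lia.
have [||P1 [F [P2 [-> s1 s2]]]] := IH (u - size D)%N => //; first lia.
exists (D :: P1), F, P2; split => //=; rewrite size_cat; lia.
Qed.

(** Halving preserves this shape: [P] holds whole pieces, with two ends inside the chain, while [A]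
    and [B] are remains of pieces cut earlier, with one end inside. The linear term pays for the
    simple subchains at which the recursion stops, the charges for the other ones. *)
Lemma tad_time_piece_charge (d : nat) (A B : chain R) (P : seq (chain R)) :
  (size (A ++ flatten P ++ B) <= 2 ^ d)%N ->
  simple_chain A -> simple_chain B -> (forall D, D \in P -> simple_chain D) ->
  (tad_time S (A ++ flatten P ++ B) <=
     2 * time_factor S * size (A ++ flatten P ++ B) +
     3 * time_factor S * (piece_charge 1 d (size A) + piece_charge 1 d (size B) +
        \sum_(D <- P) piece_charge 2 d (size D)))%N.
Proof.
elim: d A B P => [|d IHd] A B P; set C := A ++ _ => Cd sA sB sP.
  rewrite (leq_trans (tad_time_simple _)) ?leq_addr //.
  by apply/(is_simpleP S)/negPn/negP => /non_simple_size; lia.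
have [|nC] := boolP (is_simple S C).
  by move=> /is_simpleP/tad_time_simple/leq_trans; apply; rewrite leq_addr.
have C2 := non_simple_size nC.
have [u uE] : exists u, u = uphalf (size C) by eexists.
have ud : (u <= 2 ^ d)%N by rewrite uE; move: Cd; rewrite expnS; lia.
have uC : (u <= size C <= 2 * u)%N by rewrite uE; lia.
have szC : size C = (size A + size (flatten P) + size B)%N.
  by rewrite !size_cat addnA.
have szP : (\sum_(D <- P) size D = size (flatten P))%N.
  by rewrite size_flatten sumnE big_map.
(* Going from depth [d] to [d.+1] raises the total charge by exactly [size C], which pays for this
   call. *)
have PS : (\sum_(D <- P) piece_charge 2 d.+1 (size D) =
           \sum_(D <- P) piece_charge 2 d (size D) + size (flatten P))%N.
  rewrite -szP -big_split /= !big_seq; apply: eq_bigr => D DP.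
  apply: piece_chargeS_small => //; apply: leq_trans Cd; rewrite szC.
  by rewrite -szP (big_rem D) //=; lia.
rewrite PS !piece_chargeS_small //; [|lia..].
(* [X1] and [X2] are the charges that the two halves require; together they must leave [size C] of
   [X]. *)
have combine T1 T2 X1 X2 X :
    (tad_time S (take u C) <= T1)%N -> (tad_time S (drop u C) <= T2)%N ->
    (T1 <= 2 * time_factor S * u + 3 * time_factor S * X1)%N ->
    (T2 <= 2 * time_factor S * (size C - u) + 3 * time_factor S * X2)%N ->
    (size C + X1 + X2 <= X)%N ->
    (tad_time S C <= 2 * time_factor S * size C + 3 * time_factor S * X)%N.
  move=> le1 le2 le1' le2' leX; have := tad_time_split nC; rewrite -uE => leC.
  have /(leq_mul (leqnn (3 * time_factor S))) := leX; rewrite !mulnDr.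
  rewrite -{2}(subnKC (proj1 (andP uC))) mulnDr; lia.
(* Cut in [A]: the left half is simple and requires no charge. *)
have [uA|Au] := leqP u (size A).
  have tE : take u C = take u A by rewrite takel_cat.
  have dE : drop u C = drop u A ++ flatten P ++ B.
    rewrite drop_cat; case: ltnP => // Au.
    by rewrite (_ : u = size A) ?subnn ?drop0 ?drop_size //; lia.
  have szd : size (drop u A ++ flatten P ++ B) = (size C - u)%N.
    by rewrite -dE size_drop.
  apply: (combine _ _ 0%N _ _ (leqnn _) (leqnn _)).
  - rewrite tE (leq_trans (tad_time_simple _)) ?size_takel ?leq_addr //.
    exact: simple_take.
  - rewrite dE -szd; apply: IHd => //; last exact: simple_drop.
    by rewrite szd; lia.
  - have := leq_piece_charge 1 d (leq_subr u (size A)); rewrite size_drop; lia.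
(* Cut in [B]: symmetrically, the right half requires no charge. *)
have [uB|Bu] := leqP (size A + size (flatten P)) u.
  have dE : drop u C = drop (u - size A - size (flatten P)) B.
    by rewrite /C catA drop_cat size_cat ltnNge uB -subnDA.
  have tE : take u C = A ++ flatten P ++ take (u - size A - size (flatten P)) B.
    by rewrite /C catA take_cat size_cat ltnNge uB -subnDA -catA.
  have szt : size (A ++ flatten P ++ take (u - size A - size (flatten P)) B) = u.
    by rewrite -tE size_takel //; lia.
  apply: (combine _ _ _ 0%N _ (leqnn _) (leqnn _)).
  - rewrite tE; have := IHd A (take (u - size A - size (flatten P)) B) P.
    by rewrite szt; apply => //; exact: simple_take.
  - rewrite dE muln0 addn0 (leq_trans (tad_time_simple _)) ?size_drop //.
      exact: simple_drop.
    by rewrite leq_mul2l; lia.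
  - have := @leq_piece_charge 1 d
      (minn (u - size A - size (flatten P)) (size B)) (size B).
    rewrite size_take_min; lia.
(* Cut in a piece [D]: its parts become the last remainder of the left half and the first one of the
   right half, and [piece_chargeD] splits its charge. *)
have [||P1 [D [P2 [PE s1 s2]]]] := @cat_flatten_split P (u - size A)%N.
- lia.
- by move=> P0; rewrite P0 /= addn0 in Bu; lia.
set v := (u - size A - size (flatten P1))%N in s2.
have CE : C = (A ++ flatten P1 ++ take v D) ++ drop v D ++ flatten P2 ++ B.
  by rewrite /C PE flatten_cat /= -!catA [in RHS](catA (take v D)) cat_take_drop.
have sz1 : size (A ++ flatten P1 ++ take v D) = u.
  by rewrite !size_cat size_takel // /v; lia.
have tE : take u C = A ++ flatten P1 ++ take v D.
  by rewrite CE -{1}sz1 take_size_cat.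
have dE : drop u C = drop v D ++ flatten P2 ++ B.
  by rewrite CE -{1}sz1 drop_size_cat.
have sz2 : size (drop v D ++ flatten P2 ++ B) = (size C - u)%N.
  by rewrite -dE size_drop.
have sD : simple_chain D by apply: sP; rewrite PE mem_cat mem_head orbT.
apply: (combine _ _ _ _ _ (leqnn _) (leqnn _)).
- rewrite tE; have := IHd A (take v D) P1; rewrite sz1; apply=> //.
    exact: simple_take.
  by move=> E EP; apply: sP; rewrite PE mem_cat EP.
- rewrite dE -sz2; apply: IHd => //; first by rewrite sz2; lia.
    exact: simple_drop.
  by move=> E EP; apply: sP; rewrite PE mem_cat inE EP !orbT.
have := piece_chargeD d (size (take v D)) (size (drop v D)).
rewrite -size_cat cat_take_drop PE big_cat big_cons /= -PE; lia.
Qed.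
End TestAndDivide.

(** * Entropy estimates *)

(** Up to level [trunc_log 2 m] a geometric sum gives at most [4 * m]; each later level adds at most
    [m]. *)
Lemma piece_charge_le_trunc_log (d m : nat) : (0 < m <= 2 ^ d)%N ->
  (piece_charge 2 d m <= m * (4 + d - trunc_log 2 m))%N.
Proof.
move=> /andP[m0 md]; have [km mk] := andP (trunc_log_bounds (isT : (1 < 2)%N) m0).
move: (trunc_log 2 m) km mk => k km mk.
have geom e : (piece_charge 2 e m <= 4 * 2 ^ e)%N.
  elim: e => [|e IHe]; first by rewrite /piece_charge big_ord1 expn0; lia.
  by rewrite piece_chargeS (leq_trans (leq_add IHe (geq_minr _ _))) // expnS; lia.
have kd : (k <= d)%N by rewrite -(@leq_exp2l 2) //; lia.
rewrite -(subnK kd); elim: (d - k)%N => [|e IHe].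
  by rewrite add0n addnK (leq_trans (geom k)) // mulnC leq_mul2r km orbT.
rewrite piece_chargeS addnA addnK in IHe *.
by rewrite addnA addnK addnS mulnS addnC leq_add // geq_minl.
Qed.

Section Entropy.
Variable R : realType.
Implicit Types (ns : seq nat) (m n : nat).

Lemma ln2_gt0 : 0 < ln (2 : R).
Proof. by rewrite ln_gt0 // ltr1n. Qed.

Lemma ln_leB1 (x : R) : 0 < x -> ln x <= x - 1.
Proof.
by move=> x0; rewrite -{1}(subrK 1 x) addrC; apply: le_ln1Dx; lra.
Qed.

Lemma log2_ge0 (x : R) : 1 <= x -> 0 <= log2 x.
Proof. by move=> x1; apply: divr_ge0; [exact: ln_ge0|exact: ltW ln2_gt0]. Qed.

Lemma log2_le (x y : R) : 0 < x -> x <= y -> log2 x <= log2 y.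
Proof.
move=> x0 xy; rewrite ler_pM2r ?invr_gt0 ?ln2_gt0 // ler_ln ?posrE //.
exact: lt_le_trans xy.
Qed.

Lemma log2_expn2 n : log2 (2 ^ n)%:R = n%:R :> R.
Proof.
by rewrite /log2 natrX lnXn // -[_ *+ n]mulr_natl mulfK // gt_eqF ?ln2_gt0.
Qed.

Lemma log2_div (x y : R) : 0 < x -> 0 < y -> log2 (x / y) = log2 x - log2 y.
Proof. by move=> x0 y0; rewrite /log2 ln_div // mulrBl. Qed.

Lemma leq_sumn ns m : m \in ns -> (m <= sumn ns)%N.
Proof. by rewrite sumnE => mns; rewrite (big_rem m) //= leq_addr. Qed.

Lemma natr_sumn ns : (sumn ns)%:R = \sum_(m <- ns) m%:R :> R.
Proof. by rewrite sumnE natr_sum. Qed.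

Lemma mul_sumn_entropy ns : (0 < sumn ns)%N ->
  (sumn ns)%:R * entropy R ns =
  \sum_(m <- ns) m%:R * log2 ((sumn ns)%:R / m%:R) :> R.
Proof.
move=> n0; rewrite mulr_sumr; apply: eq_bigr => m _.
by field; rewrite pnatr_eq0 -lt0n.
Qed.

Lemma entropy_ge0 ns : all (leq 1) ns -> 0 <= entropy R ns.
Proof.
move=> /allP ns1; rewrite /entropy big_seq; apply: sumr_ge0 => m mns.
have m1 := ns1 _ mns; have mn := leq_sumn mns.
by rewrite mulr_ge0 // log2_ge0 // ler_pdivlMr ?ltr0n // mul1r ler_nat.
Qed.

(** Gibbs' inequality against the uniform distribution: [ln x <= x - 1] at [x = n / (m * size ns)],
    with [n = sumn ns], bounds the difference by a sum that vanishes. *)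
Lemma entropy_le_log2_size ns : all (leq 1) ns -> (0 < sumn ns)%N ->
  entropy R ns <= log2 (size ns)%:R.
Proof.
move=> /allP ns1 n0.
have n0R : 0 < (sumn ns)%:R :> R by rewrite ltr0n.
have s0 : (0 < size ns)%N by case: (ns) n0.
rewrite -(ler_pM2l n0R) mul_sumn_entropy // {2}natr_sumn mulr_suml -subr_le0 -sumrB.
have -> : \sum_(m <- ns) (m%:R * log2 ((sumn ns)%:R / m%:R) -
      m%:R * log2 (size ns)%:R) =
   (\sum_(m <- ns) m%:R * ln ((sumn ns)%:R / m%:R / (size ns)%:R)) / ln 2 :> R.
  rewrite mulr_suml !big_seq; apply: eq_bigr => m /ns1 m1.
  by rewrite ln_div ?posrE ?divr_gt0 ?ltr0n // /log2; ring.
rewrite pmulr_lle0 ?invr_gt0 ?ln2_gt0 //.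
apply: (@le_trans _ _ (\sum_(m <- ns) ((sumn ns)%:R / (size ns)%:R - m%:R))).
  rewrite big_seq [leRHS]big_seq; apply: ler_sum => m /ns1 m1.
  have m0 : 0 < m%:R :> R by rewrite ltr0n.
  have s0R : 0 < (size ns)%:R :> R by rewrite ltr0n.
  have -> : (sumn ns)%:R / (size ns)%:R - m%:R =
     m%:R * ((sumn ns)%:R / m%:R / (size ns)%:R - 1) :> R.
    by field; rewrite !gt_eqF.
  by rewrite ler_pM2l // ln_leB1 // !divr_gt0.
rewrite sumrB -natr_sumn big_const_seq count_predT iter_addr_0.
by rewrite -[X in X - _]mulr_natr divfK ?subrr // pnatr_eq0 -lt0n.
Qed.

(** The 4 of [piece_charge_le_trunc_log] becomes 6, as rounding each of the two logarithms loses at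
    most 1. *)
Lemma piece_charge_le_log2 (n m : nat) : (0 < m <= n)%N ->
  (piece_charge 2 (up_log 2 n) m)%:R <= m%:R * (6 + log2 (n%:R / m%:R)) :> R.
Proof.
move=> /andP[m0 mn]; have n0 : (0 < n)%N by lia.
have nd := up_logP n (isT : (1 < 2)%N).
have mP : (0 < m <= 2 ^ up_log 2 n)%N by rewrite m0 (leq_trans mn).
apply: (@le_trans _ _ (m * (4 + up_log 2 n - trunc_log 2 m))%:R).
  by rewrite ler_nat piece_charge_le_trunc_log.
have [_ mk] := andP (trunc_log_bounds (isT : (1 < 2)%N) m0).
have kd : (trunc_log 2 m <= up_log 2 n)%N.
  rewrite -(@leq_exp2l 2) // (leq_trans _ nd) // (leq_trans _ mn) //.
  by rewrite trunc_logP.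
rewrite natrM ler_pM2l ?ltr0n // log2_div ?ltr0n //.
have lm : log2 m%:R <= (trunc_log 2 m).+1%:R :> R.
  by rewrite -[leRHS]log2_expn2 log2_le ?ltr0n // ler_nat ltnW.
have ln : (up_log 2 n)%:R - 1 <= log2 n%:R :> R.
  have [n1|n1] := leqP n 1.
    have -> : n = 1%N by lia.
    rewrite up_log1 sub0r (le_trans (lerN10 R)) ?log2_ge0 //.
  have /andP[dn _] := up_log_bounds (isT : (1 < 2)%N) n1.
  have u0 : (0 < up_log 2 n)%N by rewrite up_log_gt0 n1.
  rewrite -{1}(prednK u0) -natr1 addrK -[leLHS]log2_expn2 log2_le ?ltr0n ?expn_gt0 //.
  by rewrite ler_nat ltnW.
by rewrite natrB ?natrD; [move: lm ln; rewrite -natr1; lra|lia].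
Qed.

Lemma simple_partition_shape (C : chain R) (P : seq (chain R)) :
  simple_partition C P -> all (leq 1) (shape P) /\ sumn (shape P) = size C.
Proof.
move=> [PC sP]; split; last by rewrite -size_flatten PC.
apply/allP => _ /mapP[D DP ->]; have [/eqP + _] := sP _ DP.
by rewrite -size_eq0 lt0n.
Qed.

(** At the root there are no remains of pieces. The constant is [2 + 3 * 6], from the linear term
    and from three times the charge. *)
Lemma tad_time_entropy (S : subroutines R) (C : chain R) (P : seq (chain R)) :
  simple_partition C P -> C <> [::] ->
  (tad_time S C)%:R <=
    (20 * time_factor S)%:R * ((size C)%:R * (1 + entropy R (shape P))).
Proof.
move=> CP /eqP; rewrite -size_eq0 -lt0n => C0.
have [shP szC] := simple_partition_shape CP; have [PC sP] := CP.
have n0R : 0 < (size C)%:R :> R by rewrite ltr0n.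
have simple0 : @simple_chain R [::] by move=> i j _; rewrite ltn0.
have := @tad_time_piece_charge R S (up_log 2 (size C)) [::] [::] P.
rewrite cat0s cats0 PC up_logP // => /(_ isT simple0 simple0).
move=> /(_ (fun D DP => (sP D DP).2)).
have piece_charge0 d : piece_charge 1 d 0 = 0%N.
  by rewrite /piece_charge big1 // => j _; rewrite min0n.
rewrite piece_charge0 !add0n -(ler_nat R) => /le_trans; apply.
have sum_le : (\sum_(D <- P) piece_charge 2 (up_log 2 (size C)) (size D))%:R <=
    (size C)%:R * (6 + entropy R (shape P)) :> R.
  rewrite natr_sum mulrDr -szC mul_sumn_entropy ?szC // -szC natr_sumn.
  rewrite mulr_suml big_map [X in _ + X]big_map -big_split /=.
  rewrite big_seq [leRHS]big_seq; apply: ler_sum => D DP.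
  rewrite -mulrDr -natr_sumn piece_charge_le_log2 //; apply/andP; split.
    by apply: (allP shP); exact: map_f.
  by apply: leq_sumn; exact: map_f.
have H0 := entropy_ge0 shP.
have t0 : 0 <= (time_factor S)%:R :> R by [].
have := mulr_ge0 t0 (mulr_ge0 (ltW n0R) H0).
have := ler_wpM2l t0 sum_le.
rewrite !(natrD, natrM); lra.
Qed.

Lemma partition_size (I : instance R) :
  [/\ all (leq 1) (shape (parts I)), sumn (shape (parts I)) = input_size I &
   (size (parts I) <= input_size I)%N].
Proof.
case: I => C P [CP ?]; rewrite /input_size /=.
have [shP szC] := simple_partition_shape CP.
split=> //; rewrite -szC.
have <- : size (shape P) = size P by rewrite size_map.
by elim: (shape P) shP => //= m ns IH /andP[m1 /IH]; lia.
Qed.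

Lemma O_class_sub (g g' : instance R -> R) (K : R) (N : nat) : 0 < K ->
  (forall I, (N <= input_size I)%N -> 0 <= g I <= K * g' I) ->
  O_class g `<=` O_class g'.
Proof.
move=> K0 gg' f /O_classP[K' K'0 [N' fg]].
apply/O_classP; exists (K' * K); first exact: mulr_gt0.
exists (maxn N N') => I; rewrite geq_max => /andP[/gg'/andP[g0 gK] /fg/le_trans].
apply; rewrite -mulrA ler_pM2l // ger0_norm // (le_trans gK) // ler_pM2l //.
exact: ler_norm.
Qed.
End Entropy.

(** * Decision trees *)

Section Counting.
Variables (R : realType) (n : nat).
Implicit Type A : decision_tree R n.

Fixpoint outcomes A (k : nat) : seq (seq 'I_n) :=
  match A, k with
  | Return s, _ => [:: s]
  | Compare _ _ _ _ _, 0%N => [::]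
  | Compare _ _ A1 A2 A3, k'.+1 =>
      outcomes A1 k' ++ outcomes A2 k' ++ outcomes A3 k'
  end.

Lemma size_outcomes A (k : nat) : (size (outcomes A k) <= 3 ^ k)%N.
Proof.
elim: A k => [s|f g A1 IH1 A2 IH2 A3 IH3] [|k] //=; first by rewrite expn_gt0.
rewrite !size_cat expnS.
by have := IH1 k; have := IH2 k; have := IH3 k; lia.
Qed.

Lemma mem_outcomes A (k : nat) (C : n.-tuple (plane R)) :
  (comparisons A C <= k)%N -> (run A C).1 \in outcomes A k.
Proof.
rewrite /comparisons.
elim: A k => [s|f g A1 IH1 A2 IH2 A3 IH3] k /=; first by case: k; rewrite mem_head.
case: k => [|k]; first by case: (run _ C).
case: ifP => _; [|case: ifP => _].
- by move: (IH1 k); case: (run A1 C) => s t /= IH /IH; rewrite mem_cat => ->.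
- by move: (IH2 k); case: (run A2 C) => s t /= IH /IH; rewrite !mem_cat => ->; rewrite orbT.
- by move: (IH3 k); case: (run A3 C) => s t /= IH /IH; rewrite !mem_cat => ->; rewrite !orbT.
Qed.

(** Pigeonhole principle. Where the output alone does not determine [x], [key] supplies the missing
    information, at the price of the factor [size D]. *)
Lemma comparisons_lower_bound (T Y : eqType) (X : seq T) (D : seq Y)
    (inst : T -> n.-tuple (plane R)) (key : T -> Y) A :
  uniq X -> X <> [::] -> {in X, forall x, key x \in D} ->
  {in X &, injective (fun x => ((run A (inst x)).1, key x))} ->
  exists2 x, x \in X & (size X <= 3 ^ comparisons A (inst x) * size D)%N.
Proof.
move=> uX X0 keyD inj.
have [x xX xmax] : exists2 x, x \in X &
    {in X, forall y, (comparisons A (inst y) <= comparisons A (inst x))%N}.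
  elim: X X0 {uX keyD inj} => // x X IH _.
  case: (altP (X =P [::])) => [->|/eqP/IH[y yX ymax]].
    by exists x; rewrite ?mem_head // => z; rewrite inE => /eqP->.
  have [xy|yx] := leqP (comparisons A (inst x)) (comparisons A (inst y)).
    exists y; first by rewrite inE yX orbT.
    by move=> z; rewrite inE => /orP[/eqP->|/ymax].
  exists x; first exact: mem_head.
  by move=> z; rewrite inE => /orP[/eqP->//|/ymax/leq_trans]; apply; exact: ltnW.
exists x => //; set k := comparisons _ _.
apply: (@leq_trans (size (outcomes A k) * size D)); last first.
  by rewrite leq_mul2r size_outcomes orbT.
rewrite -(size_map (fun x => ((run A (inst x)).1, key x))).
rewrite -(size_allpairs pair); apply: uniq_leq_size.
  by rewrite map_inj_in_uniq.
move=> _ /mapP[y yX ->]; apply: allpairs_f; last exact: keyD.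
by apply: mem_outcomes; exact: xmax.
Qed.
End Counting.

(** * Points on and above the parabola *)

Section Parabola.
Variable R : realType.
Implicit Types (p q : plane R) (C h : chain R) (x y : R).

Definition plane_point x y : plane R := \row_(j < 2) (if j == 0 then x else y).

Lemma plane_pointx x y : plane_point x y 0 0 = x. Proof. by rewrite mxE. Qed.
Lemma plane_pointy x y : plane_point x y 0 1 = y. Proof. by rewrite mxE. Qed.

Definition on_parabola x : plane R := plane_point x (x ^+ 2).

Lemma on_parabola_inj : injective on_parabola.
Proof. by move=> x y /(congr1 (fun p => p 0 0)); rewrite !plane_pointx. Qed.

Lemma plane_eqP p q : p 0 0 = q 0 0 -> p 0 1 = q 0 1 -> p = q.
Proof.
move=> e0 e1; apply/rowP => j; case: j => [[|[|//]]] jP.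
  by rewrite (_ : Ordinal jP = 0) //; apply/val_inj.
by rewrite (_ : Ordinal jP = 1) //; apply/val_inj.
Qed.

Lemma convex_half_plane (a b c : R) :
  @convex_set R (plane R) [set q : plane R | c < a * q 0 0 + b * q 0 1].
Proof.
apply/convex_setW => p q; rewrite !inE /= => cp cq l l0 l1.
rewrite inE /= /conv /= !mxE.
have m0 : 0 < 1 - l%:num by rewrite subr_gt0.
have := ltr_pM2l l0 c (a * p 0 0 + b * p 0 1); rewrite cp => {}cp.
have := ltr_pM2l m0 c (a * q 0 0 + b * q 0 1); rewrite cq => {}cq.
by rewrite /unstable.onem; lra.
Qed.

(* The tangent to the parabola at a point separates it from the rest of the
   epigraph. *)
Lemma hull_on_parabola C h (a : R) :
  is_hull C h -> (forall q, q \in C -> q 0 0 ^+ 2 <= q 0 1) ->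
  on_parabola a \in C -> on_parabola a \in h.
Proof.
move=> [_ hC _ Ch] epi aC; apply/negPn/negP => ah.
pose H := [set q : plane R | - a ^+ 2 < - (2 * a) * q 0 0 + 1 * q 0 1].
have hH : [set` h] `<=` H.
  move=> q /= qh; have := epi _ (hC _ qh) => qe.
  have [qa|qa] := eqVneq (q 0 0) a.
    rewrite /H /= qa; rewrite qa in qe.
    have : q 0 1 != a ^+ 2.
      apply: contraNneq ah => qa2; suff <- : q = on_parabola a by [].
      by apply: plane_eqP; rewrite ?plane_pointx ?plane_pointy.
    by move: qe; rewrite le_eqVlt eq_sym => /orP[/eqP->|]; rewrite ?eqxx //; lra.
  have : 0 < (q 0 0 - a) ^+ 2 by rewrite exprn_even_gt0 //= subr_eq0.
  by rewrite /H /=; move: (q 0 0) (q 0 1) qe => u v; nra.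
have := smallest_sub (@convex_half_plane _ _ _) hH (Ch _ aC).
by rewrite /H /= plane_pointx plane_pointy; lra.
Qed.

(** The projections of two edges to the first axis are disjoint, or meet only in the abscissa of the
    common vertex if the edges are adjacent. *)
Lemma simple_sorted C : sorted (fun p q => p 0 0 < q 0 0) C -> simple_chain C.
Proof.
move=> sC i j ij jC p [s /andP[s0 s1] <-] [t /andP[t0 t1] tE].
have tr : transitive (fun p q : plane R => p 0 0 < q 0 0).
  by move=> ? ? ?; exact: lt_trans.
have ltC k l : (k < l)%N -> (l < size C)%N -> C`_k 0 0 < C`_l 0 0.
  move=> kl lC; apply: (sorted_ltn_nth tr) => //; rewrite inE; lia.
have i1 := ltC i i.+1 ltac:(lia) ltac:(lia).
have j1 := ltC j j.+1 ltac:(lia) jC.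
have tE0 := congr1 (fun p : plane R => p 0 0) tE; rewrite !mxE in tE0.
case: eqP => [jE|/eqP jE].
  rewrite -tE; suff -> : t = 0 by rewrite subr0 scale1r scale0r addr0.
  move: tE0 i1 j1; rewrite jE.
  move: (C`_i 0 0) (C`_i.+1 0 0) (C`_i.+2 0 0) => u v w e uv vw.
  have : (1 - s) * (u - v) <= 0 by nra.
  have : t * (w - v) = (1 - s) * (u - v) by lra.
  nra.
have ij1 := ltC i.+1 j ltac:(lia) ltac:(lia).
exfalso; move: tE0 i1 j1 ij1.
move: (C`_i 0 0) (C`_i.+1 0 0) (C`_j 0 0) (C`_j.+1 0 0) => u v w z; nra.
Qed.

(** A Vandermonde determinant. *)
Lemma orient_on_parabola (a b c : R) :
  orient (on_parabola a) (on_parabola b) (on_parabola c) =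
  (b - a) * (c - a) * (c - b).
Proof. by rewrite /orient !plane_pointx !plane_pointy; ring. Qed.

Lemma splittable_sorted (ns : seq nat) (P : seq (chain R)) :
  all (leq 1) ns -> shape P = ns ->
  (forall D, D \in P -> sorted (fun p q => p 0 0 < q 0 0) D) ->
  splittable ns (flatten P).
Proof.
move=> ns1 shP sP; exists P => //; split=> // D DP; split; last exact/simple_sorted/sP.
move=> D0; have : size D \in ns by rewrite -shP map_f.
by move/(allP ns1); rewrite D0.
Qed.
End Parabola.

(** * Orders on the parabola *)

Lemma subseq_flatten (T : eqType) (ss : seq (seq T)) (s : seq T) :
  s \in ss -> subseq s (flatten ss).
Proof.
elim: ss => //= t ss IH; rewrite inE => /orP[/eqP->|/IH /subseq_trans].
  exact: prefix_subseq.
by apply; exact: suffix_subseq.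
Qed.

Section Ranks.
Implicit Types (b : seq nat) (bs : seq (seq nat)) (ns : seq nat).

(** For distinct entries, the permutation pattern of [b]: what sorting forgets. *)
Definition ranks b : seq nat := [seq index x (sort leq b) | x <- b].

Definition rank_words (m : nat) : seq (seq nat) :=
  [seq map val (tval t) | t <- enum {: m.-tuple 'I_m}].

Definition rank_table ns : seq (seq (seq nat)) :=
  foldr (fun m acc => [seq w :: ws | w <- rank_words m, ws <- acc]) [:: [::]] ns.

Lemma size_rank_table ns : size (rank_table ns) = (\prod_(m <- ns) m ^ m)%N.
Proof.
elim: ns => [|m ns IH]; first by rewrite big_nil.
by rewrite big_cons /= size_allpairs IH size_map -cardE card_tuple card_ord.
Qed.

Lemma ranks_in_table bs : map ranks bs \in rank_table (shape bs).
Proof.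
elim: bs => [|b bs IH]; first by rewrite inE.
apply: (allpairs_f cons) IH; rewrite /rank_words.
have rb x : x \in ranks b -> (x < size b)%N.
  by move=> /mapP[y yb ->]; rewrite -[size b](size_sort leq) index_mem mem_sort.
have sz : size (pmap insub (ranks b) : seq 'I_(size b)) == size b.
  rewrite size_pmap_sub -[X in _ == X](size_map (fun x => index x (sort leq b))).
  by rewrite -all_count; apply/allP => x /rb.
apply/mapP; exists (Tuple sz); first by rewrite mem_enum.
rewrite /= (@pmap_filter _ _ (insub : nat -> option 'I_(size b)) val); last first.
  exact: insubK.
by apply/esym/all_filterP/allP => x /rb xb; rewrite insubT.
Qed.

Lemma sort_ranks_inj bs bs' :
  map (sort leq) bs = map (sort leq) bs' -> map ranks bs = map ranks bs' -> bs = bs'.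
Proof.
elim: bs bs' => [|b bs IH] [|b' bs'] //= [sb sbs] [rb rbs].
rewrite (IH bs') //; congr cons.
have unrank c : map (nth 0%N (sort leq c)) (ranks c) = c.
  rewrite -map_comp -[RHS]map_id; apply/eq_in_map => x xc /=.
  by rewrite nth_index ?mem_sort.
by rewrite -[b]unrank -[b']unrank sb rb.
Qed.

Lemma perm_flatten_sort ns (L : seq nat) : size L = sumn ns ->
  perm_eq (flatten (map (sort leq) (reshape ns L))) L.
Proof.
move=> szL; rewrite -[X in perm_eq _ X](@reshapeKr _ ns L) ?szL //.
by elim: (reshape ns L) => //= b bs IH; apply: perm_cat => //; rewrite perm_sort.
Qed.
End Ranks.

Section Orders.
Variables (R : realType) (n : nat).
Implicit Types (xs : seq nat) (s : seq 'I_n).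

Definition parabola_chain xs : n.-tuple (plane R) :=
  [tuple on_parabola (nth 0%N xs i)%:R | i < n].

Lemma parabola_chainE xs : size xs = n ->
  parabola_chain xs = [seq on_parabola x%:R | x <- xs] :> chain R.
Proof.
move=> szx; apply: (@eq_from_nth _ 0) => [|i]; rewrite size_tuple ?size_map //.
move=> ni; rewrite (nth_map 0%N) ?szx //.
by rewrite -[i]/(val (Ordinal ni)) -tnth_nth tnth_mktuple.
Qed.

(* Following the parabola, closed at infinity, counterclockwise from [a], one
   meets [x] before [y]. *)
Definition ccw_from (a x y : nat) : bool :=
  0 < (x%:R - a%:R) * (y%:R - a%:R) * (y%:R - x%:R) :> R.

(** With [X = x - a] and [Y = y - a] nonzero, the product is [X ^ 2 * Y ^ 2 * (1 / X - 1 / Y)], so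
    the relation compares reciprocals. The identity in the proof adds two such differences with
    denominators cleared. *)
Lemma ccw_from_trans (a : nat) : transitive (ccw_from a).
Proof.
move=> y x z; rewrite /ccw_from.
set X := x%:R - _; set Y := y%:R - _; set Z := z%:R - a%:R.
rewrite (_ : y%:R - x%:R = Y - X); last by rewrite /X /Y; ring.
rewrite (_ : z%:R - y%:R = Z - Y); last by rewrite /Z /Y; ring.
rewrite (_ : z%:R - x%:R = Z - X); last by rewrite /X /Z; ring.
move: X Y Z => X Y Z xy yz.
have X0 : X != 0 by apply: contraTneq xy => ->; rewrite !mul0r ltxx.
have Y0 : Y != 0 by apply: contraTneq yz => ->; rewrite !mul0r ltxx.
have Z0 : Z != 0 by apply: contraTneq yz => ->; rewrite mulr0 mul0r ltxx.
have sq (u : R) : u != 0 -> 0 < u ^+ 2 by move=> u0; rewrite exprn_even_gt0.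
rewrite -(pmulr_rgt0 _ (sq _ Y0)).
have -> : Y ^+ 2 * (X * Z * (Z - X)) =
  Z ^+ 2 * (X * Y * (Y - X)) + X ^+ 2 * (Y * Z * (Z - Y)) by ring.
by rewrite addr_gt0 // mulr_gt0 // sq.
Qed.

(** All points of the parabola are hull vertices, and the orientation of the first vertex with two
    later ones is the product in [ccw_from]. Hence the head of [v] determines all of [v]. *)
Lemma hull_parabola_chain xs s :
  perm_eq xs (iota 0 n) ->
  is_hull (parabola_chain xs) [seq tnth (parabola_chain xs) i | i <- s] ->
  let v := [seq nth 0%N xs (val i) | i <- s] in
  [/\ uniq v, v =i iota 0 n & sorted (ccw_from (head 0%N v)) (behead v)].
Proof.
move=> xsP; have szx : size xs = n by rewrite (perm_size xsP) size_iota.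
have -> : [seq tnth (parabola_chain xs) i | i <- s] =
    [seq on_parabola (x%:R : R) | x <- [seq nth 0%N xs (val i) | i <- s]].
  by rewrite -map_comp; apply: eq_map => i /=; rewrite tnth_mktuple.
set v := [seq _ | i <- s] => H v'; rewrite {}/v'.
have injP : injective (fun x : nat => on_parabola (x%:R : R)).
  by move=> x y /on_parabola_inj/eqP; rewrite eqr_nat => /eqP.
have [uv _ ov _] := H; have {}uv := map_uniq uv.
have vE : v =i iota 0 n.
  move=> x; rewrite -(perm_mem xsP); apply/idP/idP => [/mapP[i _ ->]|xx].
    by rewrite mem_nth ?szx /=.
  rewrite -(mem_map injP); apply: (hull_on_parabola H); rewrite parabola_chainE //.
    by move=> _ /mapP[y _ ->]; rewrite plane_pointx plane_pointy.
  exact: (map_f (fun x : nat => on_parabola (x%:R : R))).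
split=> //; case: v uv vE ov {H} => //= a v _ _ ov.
rewrite (sorted_pairwise (@ccw_from_trans a)); apply/(pairwiseP 0%N) => i j iv jv ij.
have := ov 0%N i.+1 j.+1 isT ij; rewrite /= size_map => /(_ jv).
rewrite !(nth_map 0%N) ?orient_on_parabola //; exact: leq_trans jv.
Qed.

(** The first abscissa fixes the rotation of the hull, hence the abscissae in output order; matching
    them with the indices in [s] recovers the chain. *)
Lemma parabola_chain_decode xs xs' s : (0 < n)%N ->
  perm_eq xs (iota 0 n) -> perm_eq xs' (iota 0 n) ->
  is_hull (parabola_chain xs) [seq tnth (parabola_chain xs) i | i <- s] ->
  is_hull (parabola_chain xs') [seq tnth (parabola_chain xs') i | i <- s] ->
  head 0%N [seq nth 0%N xs (val i) | i <- s] =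
    head 0%N [seq nth 0%N xs' (val i) | i <- s] ->
  xs = xs'.
Proof.
move=> n0 p p' /(hull_parabola_chain p) /=[u m o].
move=> /(hull_parabola_chain p') /=[u' m' o'].
have szx : size xs = n by rewrite (perm_size p) size_iota.
have szx' : size xs' = n by rewrite (perm_size p') size_iota.
move=> hE.
have vE : [seq nth 0%N xs (val i) | i <- s] = [seq nth 0%N xs' (val i) | i <- s].
  have m0 := m 0%N; rewrite mem_iota n0 /= in m0.
  case: s => // i s in u m o u' m' o' hE m0 *; rewrite /= in u m o u' m' o' hE *.
  rewrite hE in u m o *; congr cons.
  apply: (irr_sorted_eq (@ccw_from_trans _) _ o o') => [x|x].
    by rewrite /ccw_from subrr mulr0 ltxx.
  move: u u' => /andP[/negP u _] /andP[/negP u' _].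
  have := m x; rewrite -m' !inE; case: eqP => //= ->.
  by move=> _; apply/idP/idP => [/u|/u'].
(* Every position is output, so the equality of the two lists reaches all entries of [xs] and
   [xs']. *)
have sT (i : 'I_n) : i \in s.
  have : nth 0%N xs i \in iota 0 n by rewrite -(perm_mem p) mem_nth ?szx.
  rewrite -m => /mapP[j js /eqP]; rewrite nth_uniq ?szx //.
    by move=> /eqP/val_inj->.
  by rewrite (perm_uniq p) iota_uniq.
apply: (@eq_from_nth _ 0%N); rewrite ?szx ?szx' // => i ni.
by have /eq_in_map/(_ (Ordinal ni) (sT _)) := vE.
Qed.
End Orders.

Section LowerBound.
Variables (R : realType) (ns : seq nat) (A : decision_tree R (sumn ns)).
Hypotheses (ns1 : all (leq 1) ns) (n0 : (0 < sumn ns)%N).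
Hypothesis A_correct : forall C : (sumn ns).-tuple (plane R),
  splittable ns C -> is_hull C (output A C).

(** Instead of the multinomially many chains, all permutations [L] are counted. Sorting the blocks
    of [L] gives the chain; [key] holds the start of the hull, [sumn ns] choices, and the ranks that
    undo the sorting. *)
Lemma comparisons_orders : exists2 C : (sumn ns).-tuple (plane R), splittable ns C &
  ((sumn ns)`! <=
     3 ^ comparisons A C * (sumn ns * \prod_(m <- ns) m ^ m))%N.
Proof.
pose xs L := flatten (map (sort leq) (reshape ns L)).
pose inst L := parabola_chain R (sumn ns) (xs L).
pose v L := [seq nth 0%N (xs L) (val i) | i <- (run A (inst L)).1].
pose key L := (head 0%N (v L), map ranks (reshape ns L)).
pose X := permutations (iota 0 (sumn ns)).
have XP L : L \in X -> perm_eq L (iota 0 (sumn ns)) by rewrite mem_permutations.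
have szL L : L \in X -> size L = sumn ns.
  by move=> /XP/perm_size ->; rewrite size_iota.
have xsP L : L \in X -> perm_eq (xs L) (iota 0 (sumn ns)).
  by move=> LX; apply: perm_trans (XP _ LX); apply: perm_flatten_sort; exact: szL.
have shS L : L \in X -> shape (map (sort leq) (reshape ns L)) = ns.
  move=> LX; rewrite /shape -!map_comp -[RHS](@reshapeKl _ ns L) ?szL //.
  by apply: eq_map => b /=; rewrite size_sort.
have split L : L \in X -> splittable ns (inst L).
  move=> LX; have xP := xsP L LX.
  rewrite /inst parabola_chainE ?(perm_size xP) ?size_iota // /xs map_flatten.
  apply: splittable_sorted => //.
    rewrite -[RHS](shS _ LX) /shape -!map_comp.
    by apply: eq_map => b /=; rewrite size_map.
  move=> D /mapP[_ /mapP[b bL ->] ->]; rewrite sorted_map.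
  have : sorted ltn (sort leq b).
    rewrite ltn_sorted_uniq_leq sort_sorted ?andbT; last exact: leq_total.
    rewrite sort_uniq; apply: subseq_uniq (subseq_flatten bL) _.
    by rewrite reshapeKr ?szL // (perm_uniq (XP _ LX)) iota_uniq.
  by apply: sub_sorted => x y xy /=; rewrite !plane_pointx ltr_nat.
have [||L LX|L L' LX LX' [runE headE ranksE]|L LX] :=
  @comparisons_lower_bound R _ _ _ X
    [seq (i, t) | i <- iota 0 (sumn ns), t <- rank_table ns] inst key A.
- exact: permutations_uniq.
- move=> X0; have : iota 0 (sumn ns) \in X by rewrite mem_permutations.
  by rewrite X0.
- apply: allpairs_f; last first.
    by rewrite -{2}(@reshapeKl _ ns L) ?szL //; exact: ranks_in_table.
  have [_ vE _] := hull_parabola_chain (xsP _ LX) (A_correct (split _ LX)).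
  (* Since [v L] contains 0 it is not empty, and its head is not the default value. *)
  rewrite -vE -/(v L); have := vE 0%N; rewrite mem_iota n0 -/(v L).
  by case: (v L) => //= *; rewrite mem_head.
- have H := A_correct (split _ LX); have H' := A_correct (split _ LX').
  rewrite /output -runE in H'; rewrite /v -runE in headE.
  have xsE := parabola_chain_decode n0 (xsP _ LX) (xsP _ LX') H H' headE.
  rewrite -(@reshapeKr _ ns L) ?szL // -(@reshapeKr _ ns L') ?szL //.
  congr flatten; apply: sort_ranks_inj => //.
  by rewrite -[LHS]flattenK -[RHS]flattenK !shS //; congr reshape.
- rewrite size_permutations ?iota_uniq // size_iota size_allpairs size_iota.
  by rewrite size_rank_table; exists (inst L) => //; exact: split.
Qed.
End LowerBound.

(** * Subsets of the parabola *)

(** Taken in their order in [h], three distinct vertices have positive [orient], which is 0 on a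
    line. The chord used below passes through the origin, whence the form of the equation. *)
Lemma hull_not_collinear (R : realType) (C h : chain R) (p q r : plane R) (c : R) :
  is_hull C h -> uniq [:: p; q; r] ->
  ~ {in [:: p; q; r], forall u, u \in h /\ u 0 1 = c * u 0 0}.
Proof.
move=> [_ _ oh _] u hE.
have [ph pE] := hE p ltac:(by rewrite !inE eqxx).
have [qh qE] := hE q ltac:(by rewrite !inE eqxx orbT).
have [rh rE] := hE r ltac:(by rewrite !inE eqxx !orbT).
have idx_neq v w : v \in h -> w \in h -> v != w -> index v h <> index w h.
  by move=> vh wh /eqP vw E; apply: vw; rewrite -(nth_index 0 vh) E nth_index.
have pos v w z : v \in h -> w \in h -> z \in h -> v 0 1 = c * v 0 0 ->
    w 0 1 = c * w 0 0 -> z 0 1 = c * z 0 0 ->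
    (index v h < index w h)%N -> (index w h < index z h)%N -> False.
  move=> vh wh zh vE wE zE vw wz.
  have := oh _ _ _ vw wz; rewrite index_mem => /(_ zh).
  rewrite !nth_index // /orient vE wE zE => /lt0r_neq0/eqP; apply; ring.
move: u; rewrite /= !inE !negb_or => /andP[/andP[pq pr] /andP[qr _]].
case: (ltngtP (index p h) (index q h)) (idx_neq _ _ ph qh pq) => // pq' _;
case: (ltngtP (index q h) (index r h)) (idx_neq _ _ qh rh qr) => // qr' _;
case: (ltngtP (index p h) (index r h)) (idx_neq _ _ ph rh pr) => // pr' _;
  solve [exact: (pos p q r)|exact: (pos p r q)|exact: (pos q p r)
        |exact: (pos q r p)|exact: (pos r p q)|exact: (pos r q p)|lia].
Qed.

Section LowerBound.
Variables (R : realType) (ns : seq nat) (A : decision_tree R (sumn ns)).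
Hypotheses (ns1 : all (leq 1) ns) (n0 : (0 < sumn ns)%N).
Hypothesis A_correct : forall C : (sumn ns).-tuple (plane R),
  splittable ns C -> is_hull C (output A C).

(* Lifting a point from the parabola to the chord joining the first point to
   the last one removes it from the vertices of the hull. *)
Lemma comparisons_hull_subsets :
  exists2 C : (sumn ns).-tuple (plane R), splittable ns C &
  (2 ^ sumn ns <= 3 ^ comparisons A C * 4)%N.
Proof.
set n := sumn ns.
(* The chord from [(0, 0)] to [(n - 1, (n - 1) ^ 2)] has slope [n - 1]. Its two ends are never
   lifted. *)
pose f (w : n.-tuple bool) (i : nat) : plane R :=
  if nth false w i && (0 < i < n.-1)%N then plane_point i%:R (n.-1%:R * i%:R)
  else on_parabola i%:R.
pose inst w := [tuple f w i | i < n].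
have fx w i : f w i 0 0 = i%:R by rewrite /f; case: ifP; rewrite plane_pointx.
have instE w : inst w = [seq f w i | i <- iota 0 n] :> chain R.
  apply: (@eq_from_nth _ 0) => [|i]; rewrite size_tuple ?size_map ?size_iota //.
  move=> ni; rewrite (nth_map 0%N) ?size_iota // nth_iota //.
  by rewrite -[i]/(val (Ordinal ni)) -tnth_nth tnth_mktuple.
(* Lifting keeps the abscissae increasing, so every cut gives simple pieces. *)
have split w : splittable ns (inst w).
  rewrite -(@reshapeKr _ ns (inst w)) ?size_tuple //.
  apply: splittable_sorted => //; first by rewrite reshapeKl ?size_tuple.
  move=> D /subseq_flatten; rewrite reshapeKr ?size_tuple // => /subseq_sorted; apply.
    by move=> ? ? ?; exact: lt_trans.
  rewrite instE sorted_map; apply: sub_sorted (iota_ltn_sorted 0 n) => x y xy /=.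
  by rewrite !fx ltr_nat.
have epi w q : q \in (inst w : chain R) -> q 0 0 ^+ 2 <= q 0 1.
  rewrite instE => /mapP[i]; rewrite mem_iota add0n => /andP[_ ni] ->.
  rewrite fx /f; case: ifP => _; rewrite plane_pointy //.
  by rewrite expr2 ler_wpM2r // ler_nat; lia.
have vertex w (i : 'I_n) : f w i = on_parabola i%:R ->
    i \in (run A (inst w)).1.
  move=> fE; have fin : f w i \in (inst w : chain R).
    by rewrite instE; apply: (map_f (f w)); rewrite mem_iota add0n ltn_ord.
  have := hull_on_parabola (A_correct (split w)) (@epi w); rewrite fE in fin.
  move=> /(_ _ fin) /mapP[j js]; rewrite tnth_mktuple.
  move=> /(congr1 (fun p : plane R => p 0 0)); rewrite fx plane_pointx => /eqP.
  by rewrite eqr_nat => /eqP/val_inj->.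
have lifted (w : n.-tuple bool) (i : 'I_n) : (0 < i < n.-1)%N -> tnth w i ->
    i \notin (run A (inst w)).1.
  move=> i0 wi; apply/negP => iA.
  have nn : (n.-1 < n)%N by lia.
  have fI : f w i = plane_point i%:R (n.-1%:R * i%:R) by rewrite /f -tnth_nth wi i0.
  have f0 : f w 0%N = on_parabola 0 by rewrite /f andbF.
  have fn : f w n.-1 = on_parabola n.-1%:R by rewrite /f ltnn !andbF.
  have inh (j : 'I_n) : j \in (run A (inst w)).1 -> f w j \in output A (inst w).
    by move=> jA; rewrite -(tnth_mktuple (f w)); exact: map_f.
  apply: (@hull_not_collinear R _ _ (f w 0%N) (f w i) (f w n.-1) n.-1%:R
            (A_correct (split w))).
    have neq j k : j != k -> f w j != f w k.
      apply: contraNneq => /(congr1 (fun p : plane R => p 0 0)); rewrite !fx.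
      by move/eqP; rewrite eqr_nat.
    by rewrite /= !inE !negb_or !neq //=; lia.
  move=> u; rewrite !inE => /or3P[] /eqP->; split.
  - by apply: (inh (Ordinal n0)); apply: vertex.
  - by rewrite f0 plane_pointx plane_pointy mulr0 expr0n.
  - exact: inh.
  - by rewrite fI plane_pointx plane_pointy.
  - by apply: (inh (Ordinal nn)); apply: vertex.
  - by rewrite fn plane_pointx plane_pointy expr2.
(* The bits of the two ends do not affect the chain; recording them costs the factor 4. *)
pose key (w : n.-tuple bool) := (nth false w 0, nth false w n.-1).
have [||w _|w w' _ _ [runE w0 wn]|w _] :=
  @comparisons_lower_bound R n _ _ (enum {: n.-tuple bool})
    [seq (b, c) | b <- [:: true; false], c <- [:: true; false]] inst key A.
- exact: enum_uniq.
- by move=> E; have := mem_enum {: n.-tuple bool} [tuple false | i < n]; rewrite E.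
- by apply: allpairs_f; case: (nth _ _ _).
- apply: eq_from_tnth => i.
  have [i0|] := boolP (0 < i < n.-1)%N; last first.
    rewrite !(tnth_nth false) => i0.
    have [->//|->//] : i = 0%N :> nat \/ i = n.-1 :> nat.
    by have := ltn_ord i; lia.
  have iE (u : n.-tuple bool) : tnth u i = (i \notin (run A (inst u)).1).
    have [/(lifted _ _ i0)->//|ui] := boolP (tnth u i).
    by rewrite vertex // /f -tnth_nth (negbTE ui).
  by rewrite !iE runE.
- rewrite -cardE card_tuple card_bool; exists (inst w) => //; exact: split.
Qed.
End LowerBound.

(** * From counting to entropy *)

Section Counts.
Variable R : realType.

(** Stirling's lower bound; the inductive step is [a * ln ((a + 1) / a) <= 1]. *)
Lemma ln_fact_ge (n : nat) : n%:R * ln n%:R - n%:R <= ln n`!%:R :> R.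
Proof.
elim: n => [|[|n] IH]; first by rewrite fact0 ln1 mul0r subrr.
  by rewrite ln1; lra.
rewrite factS natrM lnM ?posrE ?ltr0n ?fact_gt0 //.
have a0 : 0 < n.+1%:R :> R by rewrite ltr0n.
have b0 : 0 < n.+2%:R :> R by rewrite ltr0n.
have := ln_leB1 (divr_gt0 b0 a0); rewrite ln_div ?posrE //.
have -> : n.+2%:R / n.+1%:R - 1 = n.+1%:R^-1 :> R.
  by rewrite -[n.+2%:R]natr1; field; rewrite gt_eqF.
rewrite -(ler_pM2l a0) mulfV ?gt_eqF // mulrBr => H.
rewrite -[X in X * _ - X]natr1; move: IH H; lra.
Qed.

Lemma ln2_ge : 1 / 2 <= ln 2 :> R.
Proof.
have := @ln_leB1 R 2^-1 ltac:(by rewrite invr_gt0); rewrite lnV ?posrE //; lra.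
Qed.

Lemma ln3_le : ln 3 <= 2 * ln 2 :> R.
Proof.
rewrite mulr_natl -lnXn // ler_ln ?posrE ?exprn_gt0 //.
by rewrite -natrX ler_nat.
Qed.

Lemma linear_lower_bound (n k : nat) : (2 ^ n <= 3 ^ k * 4)%N ->
  n%:R <= 2 * k%:R + 2 :> R.
Proof.
move=> le_nk; have : (2 ^ n <= 2 ^ (2 * k + 2))%N.
  rewrite expnD expnM (leq_trans le_nk) // leq_mul2r orFb.
  by case: (k) => // j; rewrite leq_exp2r.
by rewrite leq_exp2l // -(ler_nat R) natrD natrM.
Qed.

(** Logarithms of the counting inequality. The 2 comes from [ln 3 <= 2 * ln 2]; Stirling's bound and
    [ln n <= n] lose [n] each, and dividing by [ln 2 >= 1 / 2] makes this [4 * n]. *)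
Lemma entropy_lower_bound (ns : seq nat) (k : nat) :
  all (leq 1) ns -> (0 < sumn ns)%N ->
  ((sumn ns)`! <= 3 ^ k * (sumn ns * \prod_(m <- ns) m ^ m))%N ->
  (sumn ns)%:R * entropy R ns <= 2 * k%:R + 4 * (sumn ns)%:R.
Proof.
move=> ns1 n0 le_k; set n := sumn ns in n0 le_k *.
have n0R : 0 < n%:R :> R by rewrite ltr0n.
have [prod_gt0 ln_prod] : (0 < \prod_(m <- ns) m ^ m)%N /\
    ln (\prod_(m <- ns) m ^ m)%:R = \sum_(m <- ns) m%:R * ln m%:R :> R.
  elim: (ns) ns1 => [|m s IH /= /andP[m1 /IH[s0 sE]]].
    by rewrite !big_nil ln1.
  rewrite !big_cons muln_gt0 s0 expn_gt0 m1 natrM lnM ?posrE ?ltr0n ?expn_gt0 ?m1 //.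
  by split=> //; rewrite natrX lnXn ?ltr0n // -[_ *+ m]mulr_natl sE.
have nH : n%:R * entropy R ns * ln 2 = n%:R * ln n%:R - \sum_(m <- ns) m%:R * ln m%:R.
  rewrite mul_sumn_entropy // [X in _ = X * _ - _]natr_sumn !mulr_suml -sumrB !big_seq.
  apply: eq_bigr => m /(allP ns1) m1.
  rewrite /log2 ln_div ?posrE ?ltr0n //; field.
  by rewrite gt_eqF ?ln2_gt0.
have : ln n`!%:R <= ln (3 ^ k * (n * \prod_(m <- ns) m ^ m))%:R :> R.
  by rewrite ler_ln ?posrE ?ltr0n ?fact_gt0 ?muln_gt0 ?expn_gt0 ?n0 // ler_nat.
rewrite !natrM !lnM ?posrE ?mulr_gt0 ?ltr0n ?expn_gt0 // ln_prod.
rewrite natrX lnXn // -[_ *+ k]mulr_natl => fact_le.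
have := ln_fact_ge n; have := ln_sublinear n0R; have l2 := ln2_ge; have l3 := ln3_le.
have k0 : 0 <= k%:R :> R by [].
have := ler_wpM2l k0 l3; have := ler_wpM2l (ltW n0R) l2.
move=> h1 h2 h3 h4; rewrite -(ler_pM2r (@ln2_gt0 R)) nH; lra.
Qed.
End Counts.

Theorem theorem3 (R : realType) :
  let size_entropy_bound (I : instance R) : R :=
    (input_size I)%:R * (1 + entropy R (shape (parts I))) in
  let parts_bound (I : instance R) : R :=
    (input_size I)%:R * (1 + log2 (size (parts I))%:R) in
  let size_bound (I : instance R) : R :=
    (input_size I)%:R * log2 (input_size I)%:R in
  [/\ forall S : subroutines R,
        O_class size_entropy_bound (fun I => (tad_time S (input I))%:R),
      O_class size_entropy_bound `<=` O_class parts_bound,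
      O_class parts_bound `<=` O_class size_bound &
      exists2 c : R, 0 < c & exists N : nat,
        forall ns : seq nat, all (leq 1) ns -> (N <= sumn ns)%N ->
        forall A : decision_tree R (sumn ns),
          (forall C : (sumn ns).-tuple (plane R), splittable ns C ->
             is_hull C (output A C)) ->
          exists2 C : (sumn ns).-tuple (plane R), splittable ns C &
            c * ((sumn ns)%:R * (1 + entropy R ns)) <= (comparisons A C)%:R].
Proof.
move=> size_entropy_bound parts_bound size_bound; split.
(* The successor keeps the constant positive even if [time_factor S] is 0. *)
- move=> S; apply/O_classP; exists (20 * time_factor S).+1%:R => //.
  exists 1%N => I I1; have [ns1 _ _] := partition_size I.
  have H0 := @entropy_ge0 R _ ns1.
  have b0 : 0 <= size_entropy_bound I by rewrite mulr_ge0 // addr_ge0.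
  rewrite (ger0_norm b0) ger0_norm // -natr1 mulrDl mul1r ler_wpDr //.
  move: I I1 {ns1 H0 b0} => [C P [CP ?]] /= C1; apply: tad_time_entropy => //.
  by move=> C0; move: C1; rewrite /input_size /= C0.
- apply: (@O_class_sub _ _ _ 1 1%N) => // I I1; rewrite mul1r.
  have [ns1 szI _] := partition_size I.
  rewrite mulr_ge0 ?addr_ge0 ?entropy_ge0 //= ler_wpM2l // lerD2l.
  by rewrite -(size_map size (parts I)) entropy_le_log2_size // szI.
(* From two points on, the logarithm of the size is at least 1 and absorbs the summand 1, whence the
   factor 2. *)
- apply: (@O_class_sub _ _ _ 2 2%N) => // I I2.
  have [ns1 szI szP] := partition_size I.
  have P0 : (0 < size (parts I))%N.
    by case: (parts I) szI I2 => //= <-.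
  rewrite mulr_ge0 ?addr_ge0 ?log2_ge0 ?ler1n //= mulrCA ler_wpM2l //.
  have : log2 (size (parts I))%:R <= log2 (input_size I)%:R :> R.
    by rewrite log2_le ?ltr0n // ler_nat.
  have : log2 2%:R <= log2 (input_size I)%:R :> R.
    by rewrite log2_le ?ltr0n // ler_nat.
  rewrite {1}/log2 divff ?gt_eqF ?ln2_gt0 //; lra.
(* Let [k] be the larger of the two numbers of comparisons. Then [n <= 2 * k + 2] and
   [n * H <= 2 * k + 4 * n], so [n * (1 + H) <= 12 * k + 10]; for [n >= 5] the first bound gives
   [k >= 3 / 2], hence [10 <= 8 * k]. *)
exists (1 / 20); first by lra.
exists 5%N => ns ns1 n5 A A_correct.
have n0 : (0 < sumn ns)%N by lia.
have [C1 C1ns /(linear_lower_bound R) lin] :=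
  comparisons_hull_subsets ns1 n0 A_correct.
have [C2 C2ns /(entropy_lower_bound R ns1 n0) ent] :=
  comparisons_orders ns1 n0 A_correct.
have n5R : 5 <= (sumn ns)%:R :> R by rewrite ler_nat.
have [k12|k21] := leqP (comparisons A C1) (comparisons A C2).
  exists C2 => //; move: k12; rewrite -(ler_nat R) mulrDr mulr1; lra.
exists C1 => //; move: (ltnW k21); rewrite -(ler_nat R) mulrDr mulr1; lra.
Qed.
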